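(* Let $(\mathfrak g,[-,-],(-)^{[p]},R)$ be a restricted Rota-Baxter Lie algebra of weight $\lambda\in\mathbf k$. Put $[x,y]_\lambda:=\lambda[x,y]$, $x^{[p]_\lambda}:=\lambda^{p-1}x^{[p]}$ and $x\rhd_Ry:=[R(x),y]$. Then $\mathfrak g_\lambda:=(\mathfrak g,[-,-]_\lambda,(-)^{[p]_\lambda},\rhd_R)$ is a restricted post-Lie algebra, and its subjacent restricted Lie algebra is the descendent restricted Lie algebra $(\mathfrak g,[-,-]_R,(-)^{[p]_R})$, where $[x,y]_R=[R(x),y]+[x,R(y)]+\lambda[x,y]$. In particular, in the universal enveloping algebra $\mathrm U(\mathfrak g_\lambda)$ of the Lie algebra $(\mathfrak g,[-,-]_\lambda)$, $$x^{*_{\rhd_R}p}-x^{[p]_R}=x^p-x^{[p]_\lambda},\qquad x\in\mathfrak g_\lambda,$$ where $x^{*_{\rhd_R}p}$ is the $p$-th power of $x$ with respect to the generalized Grossman-Larson product $*_{\rhd_R}$ on $\mathrm U(\mathfrak g_\lambda)$.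
   Context: Convention: $\mathbf k$ is an algebraically closed field of prime characteristic $p$; everything is over $\mathbf k$. Restricted Lie algebra: a Lie algebra $(\mathfrak g,[-,-])$ with a $p$-map $(-)^{[p]}:\mathfrak g\to\mathfrak g$ satisfying $(ax)^{[p]}=a^px^{[p]}$ for $a\in\mathbf k$, $[x^{[p]},y]=(\mathrm{ad}_x)^p(y)$, and $(x+y)^{[p]}=x^{[p]}+y^{[p]}+\sum_{i=1}^{p-1}s_i(x,y)$, where $i\,s_i(x,y)$ is the coefficient of $t^{i-1}$ in $(\mathrm{ad}_{tx+y})^{p-1}(x)\in\mathbf k[t]\otimes\mathfrak g$. For a bilinear product $\rhd$, $x^{\rhd k}:=x\rhd(x\rhd\cdots(x\rhd x)\cdots)$ ($k$ copies of $x$, $x^{\rhd1}=x$). For a composition $\alpha=(\alpha_1,\dots,\alpha_r)\vDash n$ (a tuple of positive integers with sum $n$, of length $\ell(\alpha)=r$), $C_\alpha=\prod_{k=1}^r\binom{\alpha_1+\cdots+\alpha_k-1}{\alpha_k-1}$. $\frac1r$ denotes the inverse of $r$ modulo $p$, and $\lambda^0=1$. A restricted Rota-Baxter Lie algebra $(\mathfrak g,[-,-],(-)^{[p]},R)$ of weight $\lambda$ is a restricted Lie algebra with a linear map $R$ such that $[R(x),R(y)]=R([R(x),y])+R([x,R(y)])+\lambda R([x,y])$ (Rota-Baxter operator of weight $\lambda$) and $R(x^{[p]_R})=R(x)^{[p]}$ for all $x,y\in\mathfrak g$, where $$x^{[p]_R}:=\lambda^{p-1}x^{[p]}+\sum_{r=1}^{p-1}\frac1r\lambda^{r-1}\sum_{\alpha\vDash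 p,\ \ell(\alpha)=r}C_\alpha\,[x^{\rhd_R\alpha_1},[x^{\rhd_R\alpha_2},[\cdots[x^{\rhd_R\alpha_{r-1}},x^{\rhd_R\alpha_r}]\cdots]]].$$ Post-Lie algebra: a Lie algebra $(\mathfrak g,[-,-])$ with a bilinear product $\rhd$ such that $x\rhd[y,z]=[x\rhd y,z]+[y,x\rhd z]$ and $([x,y]+x\rhd y-y\rhd x)\rhd z=x\rhd(y\rhd z)-y\rhd(x\rhd z)$. Restricted post-Lie algebra $(\mathfrak g,[-,-],(-)^{[p]},\rhd)$: a post-Lie algebra such that $(\mathfrak g,[-,-],(-)^{[p]})$ is a restricted Lie algebra and, for all $x,y$, $y\rhd x^{[p]}=(\mathrm{ad}_x)^{p-1}(y\rhd x)$ and $x^{\llbracket p\rrbracket}\rhd y=\underbrace{x\rhd(x\rhd\cdots(x}_{p}\rhd y)\cdots)$, where $$x^{\llbracket p\rrbracket}=x^{[p]}+\sum_{r=1}^{p-1}\frac1r\sum_{\alpha\vDash p,\ \ell(\alpha)=r}C_\alpha\,[x^{\rhd\alpha_1},[x^{\rhd\alpha_2},[\cdots[x^{\rhd\alpha_{r-1}},x^{\rhd\alpha_r}]\cdots]]].$$ Its subjacent restricted Lie algebra is $(\mathfrak g,\llbracket-,-\rrbracket,(-)^{\llbracket p\rrbracket})$ with $\llbracket x,y\rrbracket=x\rhd y-y\rhd x+[x,y]$. Guin-Oudom extension: for a post-Lie algebra $(\mathfrak g,[-,-],\rhd)$, $\mathrm U(\mathfrak g)$ is the universal enveloping algebra of $(\mathfrak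 g,[-,-])$ with its usual cocommutative Hopf structure (elements of $\mathfrak g$ primitive; Sweedler notation $\Delta(x)=x_1\otimes x_2$; counit $\varepsilon$). The product $\rhd$ extends uniquely to a coalgebra map $\rhd:\mathrm U(\mathfrak g)\otimes\mathrm U(\mathfrak g)\to\mathrm U(\mathfrak g)$ with $1\rhd z=z$, $x\rhd1=\varepsilon(x)1$, $x\rhd(yz)=(x_1\rhd y)(x_2\rhd z)$, $x\rhd(y\rhd z)=(x_1(x_2\rhd y))\rhd z$. The generalized Grossman-Larson product is the associative product $x*_\rhd y:=x_1(x_2\rhd y)$ on $\mathrm U(\mathfrak g)$. *)

(* Defs.v *)
From HB Require Import structures.
From mathcomp Require Import all_boot all_algebra.
From mathcomp Require Import boolp.
From mathcomp Require Import finmap.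
From mathcomp.multinomials Require Import monalg.

Set Implicit Arguments.
Unset Strict Implicit.
Unset Printing Implicit Defensive.

Import GRing.Theory.
Local Open Scope ring_scope.
Local Open Scope quotient_scope.

Section LinearFacts.
Variables (k : fieldType) (U V : lmodType k) (f : U -> V) (lf : linear f).

Lemma lin0 : f 0 = 0.
Proof. by have := lf (-1) 0 0; rewrite /= !scaleN1r !addNr. Qed.

Lemma linD x y : f (x + y) = f x + f y.
Proof. by have := lf 1 x y; rewrite /= !scale1r. Qed.

Lemma linZ a x : f (a *: x) = a *: f x.
Proof. by have := lf a x 0; rewrite /= !addr0 lin0 addr0. Qed.

Lemma linB x y : f (x - y) = f x - f y.
Proof. by rewrite linD -scaleN1r linZ scaleN1r. Qed.

End LinearFacts.

Section Quotient.
Variables (k : fieldType) (M : lmodType k) (S : M -> Prop).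

Inductive lspan : M -> Prop :=
| lspan_gen m : S m -> lspan m
| lspan0 : lspan 0
| lspanD m n : lspan m -> lspan n -> lspan (m + n)
| lspanZ a m : lspan m -> lspan (a *: m).

Definition lspan_pred : {pred M} := fun m => `[< lspan m >].

Fact lspan_zmod_closed : zmod_closed lspan_pred.
Proof.
split=> [|m n /asboolP sm /asboolP sn]; first exact/asboolP/lspan0.
by apply/asboolP/lspanD => //; rewrite -scaleN1r; apply: lspanZ.
Qed.

HB.instance Definition _ :=
  GRing.isZmodClosed.Build M lspan_pred lspan_zmod_closed.

Definition lquot := Quotient.quot lspan_pred.

HB.instance Definition _ := GRing.Zmodule.on lquot.

Definition lpi (m : M) : lquot := \pi_(Quotient.quot lspan_pred) m.
Definition lrepr (q : lquot) : M := repr (q : Quotient.quot lspan_pred).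

Lemma lreprK : cancel lrepr lpi.
Proof. by move=> q; exact: reprK. Qed.

Lemma lpiD : {morph lpi : m n / m + n}.
Proof. by move=> m n; rewrite /lpi !piE. Qed.

Lemma lpi_eqP m n : lpi m = lpi n <-> lspan (m - n).
Proof.
rewrite /lpi; split => [/eqP|sm]; first by rewrite -Quotient.idealrBE => /asboolP.
by apply/eqP; rewrite -Quotient.idealrBE; apply/asboolP.
Qed.

Lemma lpi_rel m : S m -> lpi m = 0.
Proof.
move=> Sm; have -> : 0 = lpi 0 by rewrite /lpi piE.
by apply/lpi_eqP; rewrite subr0; apply: lspan_gen.
Qed.

Lemma lspan_repr m : lspan (lrepr (lpi m) - m).
Proof. by apply/lpi_eqP; rewrite lreprK. Qed.

Fact lscale_key : unit. Proof. by []. Qed.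
Definition lscale : k -> lquot -> lquot :=
  locked_with lscale_key (fun a q => lpi (a *: lrepr q)).

Lemma lpi_scale a m : lscale a (lpi m) = lpi (a *: m).
Proof.
by rewrite /lscale unlock; apply/lpi_eqP; rewrite -scalerBr; apply/lspanZ/lspan_repr.
Qed.

Fact lscaleA a b q : lscale a (lscale b q) = lscale (a * b) q.
Proof. by rewrite -(lreprK q) !lpi_scale scalerA. Qed.

Fact lscale1 : left_id 1 lscale.
Proof. by move=> q; rewrite -(lreprK q) lpi_scale scale1r. Qed.

Fact lscaleDr : right_distributive lscale +%R.
Proof.
move=> a q r; rewrite -(lreprK q) -(lreprK r) !lpi_scale.
by rewrite -!lpiD lpi_scale scalerDr.
Qed.

Fact lscaleDl q : {morph lscale^~ q : a b / a + b}.
Proof. by move=> a b; rewrite -(lreprK q) !lpi_scale -lpiD scalerDl. Qed.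

HB.instance Definition _ :=
  GRing.Zmodule_isLmodule.Build k lquot lscaleA lscale1 lscaleDr lscaleDl.

Fact lpi_linear : linear lpi.
Proof. by move=> a m n; rewrite lpiD -lpi_scale. Qed.

HB.instance Definition _ := GRing.isLinear.Build k M lquot _ lpi lpi_linear.

Lemma lpiZ a m : lpi (a *: m) = a *: lpi m.
Proof. exact: linearZ_LR. Qed.

Lemma lquot_lift (W : lmodType k) (h : {linear M -> W}) :
  (forall m, S m -> h m = 0) -> forall m, h (lrepr (lpi m)) = h m.
Proof.
move=> hS m; apply/eqP; rewrite -subr_eq0 -linearB; apply/eqP.
elim: (lspan_repr m) => [n /hS //||n n' _ hn _ hn'|a n _ hn].
- exact: linear0.
- by rewrite linearD hn hn' addr0.
- by rewrite linearZ_LR hn scaler0.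
Qed.

End Quotient.

(** The linear extension to [{malg k[K]}], the vector space with basis [K],
    of a map defined on [K]. *)
HB.lock Definition malg_lin (k : fieldType) (K : choiceType) (W : lmodType k)
    (h : K -> W) (a : {malg k[K]}) : W :=
  \sum_(i <- msupp a) a@_i *: h i.

Section Linearize.
Variables (k : fieldType) (K : choiceType) (W : lmodType k) (h : K -> W).
Local Notation malg_lin := (malg_lin h).

Lemma malg_linEw (d : {fset K}) (a : {malg k[K]}) :
  (msupp a `<=` d)%fset -> malg_lin a = \sum_(i <- d) a@_i *: h i.
Proof.
move=> le; rewrite unlock [LHS](big_fset_incl _ le) => //= i _ /mcoeff_outdom ->.
by rewrite scale0r.
Qed.

Fact malg_lin_linear : linear malg_lin.
Proof.
move=> c a b; pose d := (msupp a `|` msupp b)%fset.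
have le_ab : (msupp (c *: a + b) `<=` d)%fset.
  by apply: fsubset_trans (msuppD_le _ _) _; apply/fsetSU/msuppZ_le.
rewrite !(@malg_linEw d) ?fsubsetUl ?fsubsetUr // scaler_sumr -big_split /=.
by apply: eq_bigr => i _; rewrite mcoeffD mcoeffZ scalerDl scalerA.
Qed.

HB.instance Definition _ :=
  GRing.isLinear.Build k {malg k[K]} W _ malg_lin malg_lin_linear.

Lemma malg_linU c i : malg_lin << c *g i >> = c *: h i.
Proof. by rewrite (malg_linEw msuppU_le) big_seq_fset1 mcoeffUU. Qed.

Lemma malgU_scale (c : k) i : << c *g i >> = c *: << i >> :> {malg k[K]}.
Proof. by apply/malgP => j; rewrite mcoeffZ !mcoeffU mulrnAr mulr1. Qed.

End Linearize.

Lemma malg_lin_ext (k : fieldType) (K : choiceType) (W : lmodType k)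
    (f f' : {linear {malg k[K]} -> W}) :
  (forall i, f << i >> = f' << i >>) -> f =1 f'.
Proof.
move=> eqf a; rewrite (monalgE a) !linear_sum; apply: eq_bigr => i _.
by rewrite malgU_scale !linearZ_LR eqf.
Qed.

Definition bilinear_map (k : fieldType) (U V W : lmodType k)
    (f : U -> V -> W) : Prop :=
  (forall u, linear (f u)) /\ (forall v, linear (f^~ v)).

Section Tensor.
Variables (k : fieldType) (U V : lmodType k).
Local Notation F := {malg k[(U * V)%type]}.

Inductive tens_rel : F -> Prop :=
| tens_relDl u u' v :
    tens_rel (<< (u + u', v) >> - << (u, v) >> - << (u', v) >>)
| tens_relDr u v v' :
    tens_rel (<< (u, v + v') >> - << (u, v) >> - << (u, v') >>)
| tens_relZl a u v : tens_rel (<< (a *: u, v) >> - a *: << (u, v) >>)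
| tens_relZr a u v : tens_rel (<< (u, a *: v) >> - a *: << (u, v) >>).

Definition tens := lquot tens_rel.

HB.instance Definition _ := GRing.Lmodule.on tens.

End Tensor.

HB.lock Definition tpure (k : fieldType) (U V : lmodType k) (u : U) (v : V) :
    tens U V :=
  lpi (@tens_rel k U V) << (u, v) >>.

(** The linear map [tens -> W] induced by [f]; meaningful for bilinear [f]. *)
HB.lock Definition tens_lift (k : fieldType) (U V W : lmodType k)
    (f : U -> V -> W) (t : tens U V) : W :=
  malg_lin (fun q => f q.1 q.2) (lrepr t).

Section TensorTheory.
Variables (k : fieldType) (U V : lmodType k).
Local Notation tens := (tens U V).
Local Notation tens_rel := (@tens_rel k U V).
Local Notation tpure := (@tpure k U V).

Fact tpure_bilinear : bilinear_map tpure.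
Proof.
split=> [u a v v'|v a u u'] /=; rewrite tpure.unlock.
  have /lpi_rel/eqP := tens_relDr u (a *: v) v'.
  have /lpi_rel/eqP := tens_relZr a u v.
  rewrite linearB linearZ_LR subr_eq0 => /eqP <-.
  by rewrite !linearB /= -addrA -opprD subr_eq0 => /eqP ->.
have /lpi_rel/eqP := tens_relDl (a *: u) u' v.
have /lpi_rel/eqP := tens_relZl a u v.
rewrite linearB linearZ_LR subr_eq0 => /eqP <-.
by rewrite !linearB /= -addrA -opprD subr_eq0 => /eqP ->.
Qed.

Section Lift.
Variables (W : lmodType k) (f : U -> V -> W) (bf : bilinear_map f).

Lemma tens_lift_pi a :
  tens_lift f (lpi tens_rel a) = malg_lin (fun q => f q.1 q.2) a.
Proof.
rewrite tens_lift.unlock; apply: lquot_lift => _ [u u' v|u v v'|b u v|b u v];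
  rewrite !linearB ?linearZ_LR /= !malg_linU !scale1r /=.
- have := bf.2 v 1 u u'; rewrite /= !scale1r => ->.
  by rewrite addrAC addrK subrr.
- have := bf.1 u 1 v v'; rewrite /= !scale1r => ->.
  by rewrite addrAC addrK subrr.
- have f0 : f 0 v = 0.
    by have := bf.2 v (-1) u u; rewrite /= !scaleN1r !addNr.
  by have := bf.2 v b u 0; rewrite /= !addr0 f0 addr0 => ->; rewrite -scalerDr subrr scaler0.
- have f0 : f u 0 = 0.
    by have := bf.1 u (-1) v v; rewrite /= !scaleN1r !addNr.
  by have := bf.1 u b v 0; rewrite /= !addr0 f0 addr0 => ->; rewrite -scalerDr subrr scaler0.
Qed.

Lemma tens_lift_pure u v : tens_lift f (tpure u v) = f u v.
Proof. by rewrite tpure.unlock tens_lift_pi malg_linU scale1r. Qed.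

Lemma tens_lift_linear : linear (tens_lift f).
Proof.
move=> a s t; rewrite -(lreprK s) -(lreprK t) -linearP !tens_lift_pi.
exact: linearP.
Qed.

End Lift.

Lemma tens_ext (W : lmodType k) (h h' : tens -> W) :
  linear h -> linear h' ->
  (forall u v, h (tpure u v) = h' (tpure u v)) -> h =1 h'.
Proof.
move=> lh lh' eqh t; rewrite -(lreprK t).
pose H := GRing.isLinear.Build _ _ _ _ _ lh.
pose hL : {linear tens -> W} := HB.pack h H.
pose H' := GRing.isLinear.Build _ _ _ _ _ lh'.
pose hL' : {linear tens -> W} := HB.pack h' H'.
by apply: (malg_lin_ext (f := hL \o lpi _) (f' := hL' \o lpi _)) => -[u v];
  have := eqh u v; rewrite tpure.unlock.
Qed.

End TensorTheory.

(** [F / I], where [I] is the two-sided ideal making [gen] linear and turning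
    [br] into the commutator. *)
Section Presentation.
Variables (k : fieldType) (g : lmodType k) (br : g -> g -> g).
Variables (F : algType k) (gen : g -> F).

Inductive uea_rel : F -> Prop :=
| uea_relD (a b : F) x y :
    uea_rel (a * (gen (x + y) - gen x - gen y) * b)
| uea_relZ (a b : F) c x : uea_rel (a * (gen (c *: x) - c *: gen x) * b)
| uea_relM (a b : F) x y :
    uea_rel (a * (gen x * gen y - gen y * gen x - gen (br x y)) * b).

Local Notation Q := (lquot uea_rel).
Local Notation pi := (lpi uea_rel).

Lemma lspan_relMl (a b : F) : lspan uea_rel b -> lspan uea_rel (a * b).
Proof.
elim=> [_ [c d x y|c d e x|c d x y]||m n _ hm _ hn|c m _ hm].
- by apply: lspan_gen; rewrite !mulrA; apply: uea_relD.
- by apply: lspan_gen; rewrite !mulrA; apply: uea_relZ.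
- by apply: lspan_gen; rewrite !mulrA; apply: uea_relM.
- by rewrite mulr0; apply: lspan0.
- by rewrite mulrDr; apply: lspanD.
- by rewrite -scalerAr; apply: lspanZ.
Qed.

Lemma lspan_relMr (a b : F) : lspan uea_rel b -> lspan uea_rel (b * a).
Proof.
elim=> [_ [c d x y|c d e x|c d x y]||m n _ hm _ hn|c m _ hm].
- by apply: lspan_gen; rewrite -mulrA; apply: uea_relD.
- by apply: lspan_gen; rewrite -mulrA; apply: uea_relZ.
- by apply: lspan_gen; rewrite -mulrA; apply: uea_relM.
- by rewrite mul0r; apply: lspan0.
- by rewrite mulrDl; apply: lspanD.
- by rewrite -scalerAl; apply: lspanZ.
Qed.

Fact rel_mul_key : unit. Proof. by []. Qed.
Definition rel_mul : Q -> Q -> Q :=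
  locked_with rel_mul_key (fun u v => pi (lrepr u * lrepr v)).

Lemma rel_mul_pi a b : rel_mul (pi a) (pi b) = pi (a * b).
Proof.
rewrite /rel_mul unlock; apply/lpi_eqP; set a' := lrepr _; set b' := lrepr _.
rewrite -(subrK (a * b') (a' * b')) -addrA -mulrBl -mulrBr; apply: lspanD.
- exact/lspan_relMr/lspan_repr.
- exact/lspan_relMl/lspan_repr.
Qed.

Fact rel_mulA : associative rel_mul.
Proof.
move=> u v w; rewrite -(lreprK u) -(lreprK v) -(lreprK w).
by rewrite !rel_mul_pi mulrA.
Qed.

Fact rel_mul1l : left_id (pi 1) rel_mul.
Proof. by move=> u; rewrite -(lreprK u) rel_mul_pi mul1r. Qed.

Fact rel_mul1r : right_id (pi 1) rel_mul.
Proof. by move=> u; rewrite -(lreprK u) rel_mul_pi mulr1. Qed.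

Fact rel_mulDl : left_distributive rel_mul +%R.
Proof.
move=> u v w; rewrite -(lreprK u) -(lreprK v) -(lreprK w).
by rewrite -linearD !rel_mul_pi -linearD mulrDl.
Qed.

Fact rel_mulDr : right_distributive rel_mul +%R.
Proof.
move=> u v w; rewrite -(lreprK u) -(lreprK v) -(lreprK w).
by rewrite -linearD !rel_mul_pi -linearD mulrDr.
Qed.

Fact rel_scaleAl a u v : a *: rel_mul u v = rel_mul (a *: u) v.
Proof.
rewrite -(lreprK u) -(lreprK v) -lpiZ !rel_mul_pi -lpiZ.
by rewrite scalerAl.
Qed.

Fact rel_scaleAr a u v : a *: rel_mul u v = rel_mul u (a *: v).
Proof.
rewrite -(lreprK u) -(lreprK v) -lpiZ !rel_mul_pi -lpiZ.
by rewrite scalerAr.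
Qed.

Lemma rel_gen_linear : linear (fun x => pi (gen x)).
Proof.
move=> a x y; have /lpi_rel/eqP := uea_relZ 1 1 a x.
rewrite mul1r mulr1 linearB linearZ_LR subr_eq0 => /eqP <-.
have /lpi_rel/eqP := uea_relD 1 1 (a *: x) y.
by rewrite mul1r mulr1 !linearB /= -addrA -opprD subr_eq0 => /eqP ->.
Qed.

Lemma rel_gen_br x y : pi (gen (br x y)) =
  rel_mul (pi (gen x)) (pi (gen y)) - rel_mul (pi (gen y)) (pi (gen x)).
Proof.
have /lpi_rel/eqP := uea_relM 1 1 x y; rewrite mul1r mulr1.
by rewrite linearB subr_eq0 linearB !rel_mul_pi => /eqP ->.
Qed.

Section Lift.
Variables (A : algType k) (f : g -> A) (ev : {linear F -> A}).
Hypotheses (evM : {morph ev : a b / a * b}) (ev_gen : forall x, ev (gen x) = f x).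
Hypotheses (lf : linear f)
  (brf : forall x y, f (br x y) = f x * f y - f y * f x).

Lemma rel_lift_pi a : ev (lrepr (pi a)) = ev a.
Proof.
apply: lquot_lift => _ [c d x y|c d e x|c d x y]; rewrite !evM.
- rewrite !linearB /= !ev_gen.
  have := lf 1 x y; rewrite /= !scale1r => ->.
  by rewrite addrAC addrK subrr mulr0 mul0r.
- have f0 : f 0 = 0 by have := lf (-1) x x; rewrite /= !scaleN1r !addNr.
  have := lf e x 0; rewrite /= !addr0 f0 addr0 => fZ.
  by rewrite linearB linearZ_LR /= !ev_gen fZ subrr mulr0 mul0r.
- by rewrite !linearB /= !evM !ev_gen brf subrr mulr0 mul0r.
Qed.

End Lift.
End Presentation.

(** The free associative algebra on the set [X]. *)
Definition freealg (k : fieldType) (X : choiceType) := {malg k[{fmonom X}]}.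

Section FreeAlgebra.
Variables (k : fieldType) (X : choiceType).
Local Notation F := (freealg k X).

HB.instance Definition _ := GRing.Lalgebra.on F.

Fact freealg_scaleAr (c : k) (a b : F) : c *: (a * b) = a * (c *: b).
Proof.
apply/malgP => w.
have -> : (c *: (a * b))@_w = c * (a * b)@_w by exact: mcoeffZ.
transitivity (c * \sum_(i <- msupp a) \sum_(j <- msupp b)
  (a@_i * b@_j) *+ (mmul i j == w)).
  by congr (_ * _); exact: mcoeffMl.
apply: etrans (esym (mcoeffMlw w (fsubset_refl _) (msuppZ_le c b))).
rewrite mulr_sumr; apply: eq_bigr => i _; rewrite mulr_sumr.
by apply: eq_bigr => j _; rewrite mcoeffZ mulrCA mulrnAr.
Qed.

HB.instance Definition _ := GRing.Lalgebra_isAlgebra.Build k F freealg_scaleAr.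

Definition fgen (x : X) : F := << fmu x >>.

Section Eval.
Variables (A : algType k) (f : X -> A).

Definition free_eval : F -> A :=
  malg_lin (fun w : {fmonom X} => \prod_(x <- (w : seq X)) f x).

HB.instance Definition _ := GRing.Linear.on free_eval.

Lemma free_eval_gen x : free_eval (fgen x) = f x.
Proof. by rewrite /free_eval malg_linU scale1r fmU big_seq1. Qed.

Lemma free_eval1 : free_eval 1 = 1.
Proof. by rewrite /free_eval malg_linU scale1r fm1 big_nil. Qed.

Lemma free_evalM : {morph free_eval : a b / a * b}.
Proof.
move=> a b; pose h (w : {fmonom X}) := \prod_(x <- (w : seq X)) f x.
have E c : free_eval c = \sum_(i <- msupp c) c@_i *: h i.
  by rewrite /free_eval malg_lin.unlock.
rewrite malgME (E a) mulr_suml linear_sum; apply: eq_bigr => i _.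
rewrite (E b) mulr_sumr linear_sum; apply: eq_bigr => j _.
rewrite /= /free_eval malg_linU fmM big_cat /=.
by rewrite -scalerAl -scalerAr scalerA.
Qed.

End Eval.
End FreeAlgebra.

Section Enveloping.
Variables (k : fieldType) (g : lmodType k) (br : g -> g -> g).
Local Notation F := (freealg k g).
Local Notation rel := (uea_rel br (@fgen k g)).

Definition uea := lquot rel.

HB.instance Definition _ := GRing.Lmodule.on uea.

Definition uea_in (x : g) : uea := lpi rel (fgen k x).

Fact uea_oner_neq0 : lpi rel 1 != 0.
Proof.
apply/eqP; rewrite -(linear0 (lpi rel)) => pi10.
have lz : linear (fun _ : g => 0 : k^o) by move=> a x y /=; rewrite scaler0 addr0.
have /(_ br) E := rel_lift_pi (free_evalM _) (free_eval_gen _) lz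
  (fun x y : g => esym (subrr _)).
have := E 1; rewrite pi10 E linear0 /= free_eval1 => /eqP.
by rewrite eq_sym oner_eq0.
Qed.

HB.instance Definition _ := GRing.Zmodule_isNzRing.Build uea
  (@rel_mulA _ _ _ _ _) (@rel_mul1l _ _ _ _ _) (@rel_mul1r _ _ _ _ _)
  (@rel_mulDl _ _ _ _ _) (@rel_mulDr _ _ _ _ _) uea_oner_neq0.
HB.instance Definition _ :=
  GRing.Lmodule_isLalgebra.Build k uea (@rel_scaleAl _ _ _ _ _).
HB.instance Definition _ :=
  GRing.Lalgebra_isAlgebra.Build k uea (@rel_scaleAr _ _ _ _ _).

End Enveloping.

(** The algebra morphism [uea -> A] induced by [f]; meaningful when [f] is a Lie
    algebra morphism to the commutator algebra of [A]. *)
HB.lock Definition uea_lift (k : fieldType) (g : lmodType k)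
    (br : g -> g -> g) (A : algType k) (f : g -> A) (u : uea br) : A :=
  free_eval f (lrepr u).

Section EnvelopingTheory.
Variables (k : fieldType) (g : lmodType k) (br : g -> g -> g).
Local Notation rel := (uea_rel br (@fgen k g)).
Local Notation uea := (uea br).
Local Notation uea_in := (uea_in br).
Local Notation uea_lift := (@uea_lift k g br _).

Lemma uea_in_linear : linear uea_in.
Proof. exact: rel_gen_linear. Qed.

Lemma uea_in_br x y :
  uea_in (br x y) = uea_in x * uea_in y - uea_in y * uea_in x.
Proof. exact: rel_gen_br. Qed.

Section Lift.
Variables (A : algType k) (f : g -> A).
Hypotheses (lf : linear f)
  (brf : forall x y, f (br x y) = f x * f y - f y * f x).

Lemma uea_lift_pi a : uea_lift f (lpi rel a) = free_eval f a.
Proof. by rewrite uea_lift.unlock; exact: (rel_lift_pi (free_evalM f) (free_eval_gen f)). Qed.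

Lemma uea_lift_in x : uea_lift f (uea_in x) = f x.
Proof. by rewrite uea_lift_pi free_eval_gen. Qed.

Lemma uea_lift_linear : linear (uea_lift f).
Proof.
move=> a u v; rewrite -(lreprK u) -(lreprK v) -lpiZ -lpiD.
by rewrite !uea_lift_pi linearP.
Qed.

Lemma uea_lift1 : uea_lift f 1 = 1.
Proof. by rewrite uea_lift_pi free_eval1. Qed.

Lemma uea_liftM : {morph uea_lift f : u v / u * v}.
Proof.
move=> u v; rewrite -(lreprK u) -(lreprK v) [_ * _ in LHS]rel_mul_pi.
by rewrite !uea_lift_pi free_evalM.
Qed.

End Lift.

Definition uea_eps : uea -> k := uea_lift (fun=> 0 : k^o).

Lemma uea_eps1 : uea_eps 1 = 1.
Proof.
rewrite /uea_eps uea_lift1 // => [a x y|x y] /=; rewrite ?subrr //.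
by rewrite scaler0 addr0.
Qed.

Lemma uea_eps_linear : linear (uea_eps : uea -> k^o).
Proof.
apply: uea_lift_linear => [a x y|x y] /=; rewrite ?subrr //.
by rewrite scaler0 addr0.
Qed.

End EnvelopingTheory.

HB.lock Definition tens_mul (k : fieldType) (A B : algType k)
    (s t : tens A B) : tens A B :=
  tens_lift (fun a b => tens_lift (fun c d => tpure (a * c) (b * d)) t) s.

Section TensorAlgebra.
Variables (k : fieldType) (A B : algType k).
Local Notation T := (tens A B).
Local Notation tens_mul := (@tens_mul k A B).

Let inner_bilinear a b :
  bilinear_map (fun c d => tpure (a * c) (b * d) : T).
Proof.
split=> [c e d d'|d e c c'] /=; rewrite mulrDr -scalerAr.
  exact: (tpure_bilinear _ _).1.
exact: (tpure_bilinear _ _).2.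
Qed.

Let outer_bilinear t :
  bilinear_map (fun a b =>
    tens_lift (fun c d => tpure (a * c) (b * d) : T) t).
Proof.
have L a b := tens_lift_linear (inner_bilinear a b).
have P a b := tens_lift_pure (inner_bilinear a b).
split=> [a e b b'|b e a a'] /=; move: t; apply: tens_ext.
- exact: L.
- move=> x s t; rewrite (L a b) (L a b').
  by rewrite !scalerDr addrACA !scalerA [x * e]mulrC.
- move=> c d; rewrite !P mulrDl -scalerAl; exact: (tpure_bilinear _ _).1.
- exact: L.
- move=> x s t; rewrite (L a b) (L a' b).
  by rewrite !scalerDr addrACA !scalerA [x * e]mulrC.
- move=> c d; rewrite !P mulrDl -scalerAl; exact: (tpure_bilinear _ _).2.
Qed.

Lemma tens_mul_bilinear : bilinear_map tens_mul.
Proof.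
have L t := tens_lift_linear (outer_bilinear t).
have P t := tens_lift_pure (outer_bilinear t).
split=> [s e t t'|t e s s']; last by rewrite tens_mul.unlock; exact: L.
move: s; apply: tens_ext.
- by rewrite tens_mul.unlock; exact: L.
- move=> x s s'; rewrite tens_mul.unlock (L t) (L t').
  by rewrite !scalerDr addrACA !scalerA [x * e]mulrC.
- move=> a b; rewrite tens_mul.unlock !P; exact: tens_lift_linear.
Qed.

Lemma tens_mul_pure a b c d :
  tens_mul (tpure a b) (tpure c d) = tpure (a * c) (b * d).
Proof. by rewrite tens_mul.unlock !tens_lift_pure. Qed.

Fact tens_mulA : associative tens_mul.
Proof.
have [lr ll] := tens_mul_bilinear.
move=> r s t; move: r; apply: tens_ext => [a x y|a x y|a b].
- exact: ll.
- by rewrite (ll s) (ll t).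
move: s; apply: tens_ext => [e x y|e x y|c d].
- by rewrite (ll t) lr.
- by rewrite lr (ll t).
move: t; apply: tens_ext => [x y z|x y z|c' d'].
- by rewrite !lr.
- by rewrite lr.
by rewrite !tens_mul_pure !mulrA.
Qed.

Fact tens_mul1l : left_id (tpure 1 1) tens_mul.
Proof.
have [lr ll] := tens_mul_bilinear.
apply: tens_ext => [a x y|//|a b]; first exact: lr.
by rewrite tens_mul_pure !mul1r.
Qed.

Fact tens_mul1r : right_id (tpure 1 1) tens_mul.
Proof.
have [lr ll] := tens_mul_bilinear.
apply: tens_ext => [a x y|//|a b]; first exact: ll.
by rewrite tens_mul_pure !mulr1.
Qed.

Fact tens_mulDl : left_distributive tens_mul +%R.
Proof.
have [lr ll] := tens_mul_bilinear.
by move=> x y z; have := ll z 1 x y; rewrite /= !scale1r.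
Qed.

Fact tens_mulDr : right_distributive tens_mul +%R.
Proof.
have [lr ll] := tens_mul_bilinear.
by move=> x y z; have := lr x 1 y z; rewrite /= !scale1r.
Qed.

Fact tens_scaleAl a (s t : T) : a *: tens_mul s t = tens_mul (a *: s) t.
Proof.
have [lr ll] := tens_mul_bilinear.
have l0 : tens_mul 0 t = 0.
  by have := ll t (-1) 0 0; rewrite /= !scaleN1r !addNr.
by have := ll t a s 0; rewrite /= !addr0 l0 addr0.
Qed.

Fact tens_scaleAr a (s t : T) : a *: tens_mul s t = tens_mul s (a *: t).
Proof.
have [lr ll] := tens_mul_bilinear.
have l0 : tens_mul s 0 = 0.
  by have := lr s (-1) 0 0; rewrite /= !scaleN1r !addNr.
by have := lr s a t 0; rewrite /= !addr0 l0 addr0.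
Qed.

End TensorAlgebra.

Lemma commutator_sum (V : zmodType) (a a' b c d d' : V) :
  (a - a') + (d - d') = (a + b + (c + d)) - (a' + c + (b + d')).
Proof.
have -> : a + b + (c + d) = a + d + (b + c) by rewrite [c + d]addrC addrACA.
have -> : a' + c + (b + d') = a' + d' + (b + c).
  by rewrite [b + d']addrC addrACA [c + b]addrC.
by rewrite opprD [RHS]addrACA subrr addr0 opprD addrACA.
Qed.

Section Coproduct.
Variables (k : fieldType) (g : lmodType k) (br : g -> g -> g).
Local Notation U := (uea br).

Definition uea2 := tens U U.

HB.instance Definition _ := GRing.Lmodule.on uea2.

Fact uea2_oner_neq0 : (tpure 1 1 : uea2) != 0.
Proof.
apply/eqP => E.
have bf : @bilinear_map k U U k^o (fun u v => uea_eps u * uea_eps v).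
  split=> [u a v v'|v a u u'] /=; rewrite uea_eps_linear.
    by rewrite mulrDr; congr (_ + _); rewrite [LHS]mulrCA.
  by rewrite mulrDl; congr (_ + _); rewrite -[LHS]mulrA.
have := tens_lift_pure bf 1 1; rewrite E !uea_eps1 mulr1.
have l0 : tens_lift (W := k^o) (fun u v : U => uea_eps u * uea_eps v) 0 = 0.
  by have := tens_lift_linear bf (-1) 0 0; rewrite /= !scaleN1r !addNr.
by rewrite l0 => /eqP; rewrite eq_sym oner_eq0.
Qed.

HB.instance Definition _ := GRing.Zmodule_isNzRing.Build uea2
  (@tens_mulA k U U) (@tens_mul1l k U U) (@tens_mul1r k U U)
  (@tens_mulDl k U U) (@tens_mulDr k U U) uea2_oner_neq0.
HB.instance Definition _ :=
  GRing.Lmodule_isLalgebra.Build k uea2 (@tens_scaleAl k U U).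
HB.instance Definition _ :=
  GRing.Lalgebra_isAlgebra.Build k uea2 (@tens_scaleAr k U U).

Definition uea_delta : U -> uea2 :=
  uea_lift (fun x => tpure (uea_in br x) 1 + tpure 1 (uea_in br x) : uea2).


Let prim_linear :
  linear (fun x => tpure (uea_in br x) 1 + tpure 1 (uea_in br x) : uea2).
Proof.
have [lr ll] := tpure_bilinear U U.
move=> a x y; rewrite uea_in_linear; move: (uea_in br x) (uea_in br y) => u v.
by rewrite (ll 1) (lr 1) scalerDr addrACA.
Qed.

Let prim_br x y (d := fun x => tpure (uea_in br x) 1 + tpure 1 (uea_in br x) : uea2) :
  d (br x y) = d x * d y - d y * d x.
Proof.
rewrite /d uea_in_br; move: (uea_in br x) (uea_in br y) => u v.
have M a b c e : (tpure a b : uea2) * tpure c e = tpure (a * c) (b * e).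
  exact: tens_mul_pure.
have [lr ll] := tpure_bilinear U U.
rewrite (linB (ll 1)) (linB (lr 1)) !(mulrDl, mulrDr) !M !(mul1r, mulr1).
exact: commutator_sum.
Qed.

Lemma uea_delta_in x :
  uea_delta (uea_in br x) = tpure (uea_in br x) 1 + tpure 1 (uea_in br x).
Proof. exact: (uea_lift_in prim_linear prim_br). Qed.

Lemma uea_delta_linear : linear uea_delta.
Proof. exact: (uea_lift_linear prim_linear prim_br). Qed.

Lemma uea_delta1 : uea_delta 1 = 1.
Proof. exact: (uea_lift1 prim_linear prim_br). Qed.

Lemma uea_deltaM : {morph uea_delta : u v / u * v}.
Proof. exact: (uea_liftM prim_linear prim_br). Qed.

End Coproduct.

Section Restricted.
Variables (k : fieldType) (g : lmodType k) (p : nat).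
Implicit Types (br rhd : g -> g -> g) (pm : g -> g) (x y z : g).

Record is_lie br : Prop := IsLie {
  lie_bilinear : bilinear_map br;
  lie_alt : forall x, br x x = 0;
  lie_jacobi : forall x y z,
    br x (br y z) + br y (br z x) + br z (br x y) = 0
}.

(** An element of [k[t] (x) g] is given by its coefficients [c i], [i : nat];
    this is [ad_(t x + y)]. *)
Definition ad_txy br x y (c : nat -> g) : nat -> g :=
  fun i => (if i is j.+1 then br x (c j) else 0) + br y (c i).

Definition jacobson_s br x y (i : nat) : g :=
  i%:R^-1 *: iter p.-1 (ad_txy br x y) (fun j => if j is 0 then x else 0) i.-1.

Record is_restricted_lie br pm : Prop := IsRestrictedLie {
  restricted_lie : is_lie br;
  pmapZ : forall a x, pm (a *: x) = a ^+ p *: pm x;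
  pmap_ad : forall x y, br (pm x) y = iter p (br x) y;
  pmapD : forall x y,
    pm (x + y) = pm x + pm y + \sum_(1 <= i < p) jacobson_s br x y i
}.

Record is_postlie br rhd : Prop := IsPostLie {
  postlie_lie : is_lie br;
  postlie_bilinear : bilinear_map rhd;
  postlie_der : forall x y z,
    rhd x (br y z) = br (rhd x y) z + br y (rhd x z);
  postlie_assoc : forall x y z,
    rhd (br x y + rhd x y - rhd y x) z = rhd x (rhd y z) - rhd y (rhd x z)
}.

Definition rhd_pow rhd x (n : nat) : g := iter n.-1 (rhd x) x.

Definition is_composition (n : nat) (s : seq nat) : bool :=
  all (leq 1) s && (sumn s == n).

Definition comp_coef (s : seq nat) : nat :=
  \prod_(i < size s) 'C((sumn (take i.+1 s)).-1, (nth 0%N s i).-1).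

Fixpoint nested_br br (s : seq g) : g :=
  match s with
  | [::] => 0
  | [:: x] => x
  | x :: s' => br x (nested_br br s')
  end.

(** The inner sum, over compositions of [p] of length [r]; their parts are at
    most [p], hence the type of the summation index. *)
Definition comp_sum br rhd x (r : nat) : g :=
  \sum_(a : r.-tuple 'I_p.+1 | is_composition p (map val a))
    (comp_coef (map val a))%:R
      *: nested_br br [seq rhd_pow rhd x n | n <- map val a].

Definition sub_br br rhd x y : g := rhd x y - rhd y x + br x y.

Definition sub_pmap br pm rhd x : g :=
  pm x + \sum_(1 <= r < p) r%:R^-1 *: comp_sum br rhd x r.

Record is_restricted_postlie br pm rhd : Prop := IsRestrictedPostLie {
  rpostlie_postlie : is_postlie br rhd;
  rpostlie_restricted : is_restricted_lie br pm;
  rpostlie_pmap_r : forall x y, rhd y (pm x) = iter p.-1 (br x) (rhd y x);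
  rpostlie_pmap_l : forall x y,
    rhd (sub_pmap br pm rhd x) y = iter p (rhd x) y
}.

Definition rb_rhd br (R : g -> g) x y : g := br (R x) y.

Definition rb_br br (R : g -> g) (lam : k) x y : g :=
  br (R x) y + br x (R y) + lam *: br x y.

Definition rb_pmap br pm (R : g -> g) (lam : k) x : g :=
  lam ^+ p.-1 *: pm x
  + \sum_(1 <= r < p) (r%:R^-1 * lam ^+ r.-1) *: comp_sum br (rb_rhd br R) x r.

Record is_restricted_rota_baxter br pm (R : g -> g) (lam : k) : Prop :=
  IsRestrictedRotaBaxter {
  rrb_restricted : is_restricted_lie br pm;
  rrb_linear : linear R;
  rrb_rota_baxter : forall x y,
    br (R x) (R y) = R (br (R x) y) + R (br x (R y)) + lam *: R (br x y);
  rrb_pmap : forall x, R (rb_pmap br pm R lam x) = pm (R x)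
}.

Definition scaled_br br (lam : k) x y : g := lam *: br x y.
Definition scaled_pmap pm (lam : k) x : g := lam ^+ p.-1 *: pm x.

End Restricted.

Section GuinOudom.
Variables (k : fieldType) (g : lmodType k) (br rhd : g -> g -> g).
Local Notation U := (uea br).

(** In Sweedler notation, [sweedler f u] is the sum of the [f u_1 u_2]. *)
Definition sweedler (W : lmodType k) (f : U -> U -> W) (u : U) : W :=
  tens_lift f (uea_delta u).

Record is_guin_oudom (ext : U -> U -> U) : Prop := IsGuinOudom {
  go_bilinear : bilinear_map ext;
  go_extends : forall x y,
    ext (uea_in br x) (uea_in br y) = uea_in br (rhd x y);
  go_delta : forall u v, uea_delta (ext u v) =
    sweedler (fun u1 u2 =>
      sweedler (fun v1 v2 => tpure (ext u1 v1) (ext u2 v2)) v) u;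
  go_eps : forall u v, uea_eps (ext u v) = uea_eps u * uea_eps v;
  go_1l : forall v, ext 1 v = v;
  go_1r : forall u, ext u 1 = uea_eps u *: 1;
  go_mul : forall u v w,
    ext u (v * w) = sweedler (fun u1 u2 => ext u1 v * ext u2 w) u;
  go_comp : forall u v w,
    ext u (ext v w) = ext (sweedler (fun u1 u2 => u1 * ext u2 v) u) w
}.

Definition gl_mul (ext : U -> U -> U) (u v : U) : U :=
  sweedler (fun u1 u2 => u1 * ext u2 v) u.

(** For [n >= 1]; the product is associative. *)
Definition gl_pow (ext : U -> U -> U) (u : U) (n : nat) : U :=
  iter n.-1 (gl_mul ext u) u.

End GuinOudom.

(* Main.v *)
(** For [t] in [k] let [L_t] be the space [g * g] with the bracket
    [((a, u), (b, v)) |-> ([a, b], [a, v] + [u, b] + t [u, v])] and the p-map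
    [(a, u) |-> (a^[p], t^(p-1) u^[p] + \sum_r t^(r-1) s_r(u, a))].
    If [t != 0], then [(a, u) |-> a] and [(a, u) |-> a + t u] jointly embed [L_t]
    into [g * g], so [L_t] is restricted; its axioms are polynomial identities in
    [t], so they persist at [t = 0] because [k] is infinite.  The sum over
    compositions of length [r] is the coefficient of [t^(r-1)] in
    [(t ad_x + ad_(R x))^(p-1) (x)], that is [r s_r(x, R x)]; hence
    [x |-> (R x, x)] embeds the descendent algebra into [L_lam] as a restricted
    subalgebra.

    In the enveloping algebra, multiplying by [x] for the Grossman-Larson product
    is [L_x + D], with [D] the derivation extending [x |>].  Differentiating
    [(t L_x + D)^p (1)] with respect to [t] gives [(t ad_x + D)^(p-1) (x)], so
    the p-th Grossman-Larson power of [x] is [x^p] plus the same sum over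
    compositions. *)

Require Import Defs.
From mathcomp Require Import all_boot all_algebra.

Set Implicit Arguments.
Unset Strict Implicit.
Unset Printing Implicit Defensive.

Import GRing.Theory.
Local Open Scope ring_scope.

(** * Weighted sums over compositions *)

Section CompositionSums.
Variable V : zmodType.
Implicit Types (F G : seq nat -> V) (r n m : nat) (s : seq nat).

(** This is the sum of [F] over the compositions of [n] of length [r], weighted by [C_alpha]. It
    peels off the last part [m.+1] because that part enters only the last factor of [C_alpha], which
    is ['C(n.-1, m)]. *)
Fixpoint csum r n F : V :=
  if r is r'.+1 then
    \sum_(m < n) csum r' (n - m.+1) (fun s => F (rcons s m.+1)) *+ 'C(n.-1, m)
  else if n is 0 then F [::] else 0.

Lemma csumS r n F : csum r.+1 n F =
  \sum_(m < n) csum r (n - m.+1) (fun s => F (rcons s m.+1)) *+ 'C(n.-1, m).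
Proof. by []. Qed.

Lemma eq_csum r n F G :
  (forall s, all (leq 1) s -> size s = r -> F s = G s) -> csum r n F = csum r n G.
Proof.
elim: r n F G => [|r IH] n F G eFG; first by case: n => //=; apply: eFG.
apply: eq_bigr => m _; congr (_ *+ _); apply: IH => s s1 sr.
by apply: eFG; rewrite ?all_rcons ?s1 // size_rcons sr.
Qed.

Lemma csumD r n F G : csum r n (fun s => F s + G s) = csum r n F + csum r n G.
Proof.
elim: r n F G => [|r IH] n F G; first by case: n => //= *; rewrite addr0.
by rewrite !csumS -big_split; apply: eq_bigr => m _; rewrite IH mulrnDl.
Qed.

#[local] Arguments csum : simpl never.

(* The coefficient of a composition counts the set partitions whose blocks,
   ordered by their maxima, have the given sizes; adding a new minimum to such
   a partition gives this recursion. *)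
Lemma csum_rec r n F :
  csum r.+1 n.+1 F = csum r n (fun s => F (1%N :: s))
    + csum r.+1 n (fun s => \sum_(j < size s) F (incr_nth s j)).
Proof.
elim: r n F => [|r IH] [|n] F.
- by rewrite !csumS big_ord_recl !big_ord0 !addr0 subnn bin0 mulr1n.
- rewrite !csumS [csum 0 n.+1 _]/csum add0r.
  rewrite [LHS]big_ord_recr [RHS]big_ord_recr /= !subnn !binn.
  rewrite !mulr1n !big1 ?add0r /csum /= ?big_ord1 // => m _.
    by rewrite subSS -[(n - m)%N]prednK ?subn_gt0 // mul0rn.
  by rewrite subSS -[(n.+1 - m)%N]prednK ?subn_gt0 // mul0rn.
- by rewrite csumS big_ord_recl !csumS !big_ord0 mul0rn !addr0.
have incr_rcons s m : \sum_(j < size (rcons s m)) F (incr_nth (rcons s m) j)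
    = \sum_(j < size s) F (rcons (incr_nth s j) m) + F (rcons s m.+1).
  rewrite size_rcons big_ord_recr /=; congr (_ + _).
    apply: eq_bigr => j _; congr F; elim: s j => [[]//|y s IHs] [[|j] lt_j] //=.
    by rewrite (IHs (Ordinal (lt_j : (j < size s)%N))).
  by congr F; elim: s => //= y s ->.
rewrite [in LHS]csumS big_ord_recl [nat_of_ord ord0]/= subSS subn0 bin0 mulr1n.
(* By Pascal's rule the coefficient splits in two: the summand ['C(n, m)], with last part [m.+2],
   matches raising the last part on the right; the summand ['C(n, m.+1)] is left for the induction
   hypothesis. *)
under eq_bigr => m _ do rewrite lift0 subSS [_.-1]/= binS mulrnDr.
rewrite big_split addrA /=.
rewrite [csum r.+2 n.+1 _ in RHS]csumS.
under [in X in _ = _ + X]eq_bigr => m _.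
  rewrite (@eq_csum _ _ _ (fun s => \sum_(j < size s)
    F (rcons (incr_nth s j) m.+1) + F (rcons s m.+2)));
    last by move=> s _ _; rewrite incr_rcons.
  rewrite csumD mulrnDl subSS; over.
rewrite big_split addrA /=; congr (_ + _).
transitivity (\sum_(m < n.+2) csum r.+1 (n.+1 - m)
  (fun s => F (rcons s m.+1)) *+ 'C(n, m)).
  by rewrite [RHS]big_ord_recl subn0 bin0 mulr1n.
rewrite big_ord_recr /= subnn.
rewrite [csum r.+1 n.+1 (fun s => F (1%N :: s)) in RHS]csumS -big_split.
rewrite [X in _ + X](_ : _ = 0); last by rewrite bin_small // mulr0n.
rewrite addr0; apply: eq_bigr => m _.
have le_mn : (m <= n)%N by rewrite -ltnS.
by rewrite subSS subSn // IH mulrnDl.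
Qed.

Lemma comp_coef_rcons s m :
  comp_coef (rcons s m) = (comp_coef s * 'C((sumn s + m).-1, m.-1))%N.
Proof.
rewrite /comp_coef size_rcons big_ord_recr /=; congr (_ * _)%N.
  apply: eq_bigr => i _; rewrite -cats1 nth_cat ltn_ord.
  by rewrite takel_cat.
rewrite nth_rcons ltnn eqxx take_oversize ?size_rcons //.
by rewrite -cats1 sumn_cat /= addn0.
Qed.

Lemma is_composition_rcons n s m : is_composition n (rcons s m)
  = (0 < m <= n)%N && is_composition (n - m) s.
Proof.
rewrite /is_composition all_rcons -cats1 sumn_cat /= addn0.
case: (0 < m)%N => //=; case: (leqP m n) => [le_mn|lt_nm] /=.
  by rewrite -[in RHS](eqn_add2r m) subnK.
rewrite andbC; case: eqP => //= e; move: lt_nm.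
by rewrite -e ltnNge leq_addl.
Qed.

Lemma big_rcons_tuple (T : finType) r (P : pred (seq T)) (H : seq T -> V) :
  \sum_(a : r.+1.-tuple T | P a) H a
    = \sum_(m : T) \sum_(a : r.-tuple T | P (rcons a m)) H (rcons a m).
Proof.
pose f (q : T * r.-tuple T) : r.+1.-tuple T := [tuple of rcons q.2 q.1].
have f_inj : injective f.
  move=> [m a] [m' a'] /(congr1 val) /= /rcons_inj [e ->]; congr (_, _).
  exact: val_inj.
have f_bij : bijective f.
  by apply: inj_card_bij f_inj _; rewrite card_prod !card_tuple expnS.
rewrite (reindex f) /=; last exact: onW_bij.
by rewrite pair_big_dep /=; apply: eq_big => -[m a].
Qed.

(** The bound [N] on the parts is kept apart from [n], since the induction lowers [n] while the
    index type stays fixed. *)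
Lemma comp_sum_csum N r n F : (n <= N)%N ->
  \sum_(a : r.-tuple 'I_N.+1 | is_composition n (map val a))
    F (map val a) *+ comp_coef (map val a) = csum r n F.
Proof.
elim: r n F => [|r IH] n F leN.
  rewrite (eq_bigl (fun a => (a == [tuple]) && (n == 0%N))); last first.
    by move=> a; rewrite [a]tuple0 eqxx /= /is_composition /= eq_sym.
  case: n leN => [|n] _; rewrite /csum /=.
    rewrite (eq_bigl (pred1 [tuple])) => [|a]; last by rewrite /= andbT.
    by rewrite big_pred1_eq /= /comp_coef /= big_ord0 mulr1n.
  by rewrite big1 // => a; rewrite andbF.
rewrite (big_rcons_tuple _ (fun a => is_composition n (map val a))
  (fun a => F (map val a) *+ comp_coef (map val a))).
rewrite big_ord_recl big1 ?add0r => [|a]; last first.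
  by rewrite map_rcons is_composition_rcons.
rewrite (bigID (fun m : 'I_N => (m < n)%N)) /= addrC big1 ?add0r; last first.
  move=> m le_nm; rewrite big1 // => a; rewrite map_rcons is_composition_rcons.
  by rewrite lift0 (negPf le_nm).
rewrite csumS (big_ord_widen N (fun m : nat => csum r (n - m.+1)
  (fun s => F (rcons s m.+1)) *+ 'C(n.-1, m))) //; apply: eq_bigr => m lt_mn.
rewrite -IH ?(leq_trans (leq_subr _ _)) // -sumrMnl; apply: eq_big => a.
  by rewrite map_rcons is_composition_rcons lift0 lt_mn.
rewrite map_rcons is_composition_rcons lift0 lt_mn => /andP[_ /andP[_ /eqP sa]].
by rewrite comp_coef_rcons sa subnK // mulrnA.
Qed.

End CompositionSums.

Lemma raddf_csum (V W : zmodType) (h : V -> W) r n F :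
  {morph h : a b / a + b} -> h 0 = 0 ->
  h (csum r n F) = csum r n (h \o F).
Proof.
move=> hD h0; have hMn a m : h (a *+ m) = h a *+ m.
  by elim: m => [|m IH]; rewrite ?mulr0n // !mulrS hD IH.
elim: r n F => [|r IH] n F; first by case: n.
by rewrite !csumS (big_morph h hD h0); apply: eq_bigr => m _; rewrite hMn IH.
Qed.

(** * Coefficients of powers of [t ad_x + D] for a derivation [D] *)

Section AdDerivation.
Variables (k : fieldType) (g : lmodType k) (br rhd : g -> g -> g) (x : g).

(* Like [ad_txy], this is the operator [t ad_x + D] on coefficient sequences,
   with [D = rhd x]. *)
Definition ad_der (c : nat -> g) : nat -> g :=
  fun i => (if i is j.+1 then br x (c j) else 0) + rhd x (c i).

Definition delta0 (i : nat) : g := if i is 0 then x else 0.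

Hypotheses (br_lin : bilinear_map br) (rhd_lin : linear (rhd x)).
Hypothesis rhd_der : forall y z,
  rhd x (br y z) = br (rhd x y) z + br y (rhd x z).

(** By the Leibniz rule [rhd x] hits one entry at a time, and on a power of [x] it raises the
    exponent by one. *)
Lemma rhd_nested s : all (leq 1) s ->
  rhd x (nested_br br [seq rhd_pow rhd x n | n <- s])
  = \sum_(j < size s) nested_br br [seq rhd_pow rhd x n | n <- incr_nth s j].
Proof.
have rhd_powS m : (0 < m)%N -> rhd x (rhd_pow rhd x m) = rhd_pow rhd x m.+1.
  by case: m.
elim: s => [_|m s IH /= /andP[m_gt0 s_pos]]; first by rewrite big_ord0 /= lin0.
case: s IH s_pos => [|m' s] IH s_pos.
  by rewrite big_ord1 /= rhd_powS.
have nestedE y n t : nested_br br [seq rhd_pow rhd y i | i <- [:: n & incr_nth (m' :: s) t]]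
    = br (rhd_pow rhd y n) (nested_br br [seq rhd_pow rhd y i | i <- incr_nth (m' :: s) t]).
  by case: t.
rewrite [LHS]rhd_der [X in _ + br _ X]IH // [RHS]big_ord_recl rhd_powS //.
congr (_ + _); rewrite (big_morph _ (linD (br_lin.1 _)) (lin0 (br_lin.1 _))).
by apply: eq_bigr => j _; rewrite lift0 -nestedE.
Qed.

(** The term [t ad_x] prepends a part 1 and the term [D] raises one part, which is exactly the
    recursion [csum_rec]. *)
Lemma iter_ad_der n i : iter n ad_der delta0 i
  = csum i.+1 n.+1 (fun s => nested_br br [seq rhd_pow rhd x m | m <- s]).
Proof.
elim: n i => [|n IH] i.
  case: i => [|i]; last by rewrite csumS big_ord1 csumS big_ord0 mul0rn.
  by rewrite csumS big_ord1 mulr1n.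
rewrite iterS csum_rec {1}/ad_der IH; congr (_ + _).
  case: i => [|i] //; rewrite IH.
  rewrite (raddf_csum _ _ _ (linD (br_lin.1 x)) (lin0 (br_lin.1 x))).
  by apply: eq_csum => -[].
rewrite (raddf_csum _ _ _ (linD rhd_lin) (lin0 rhd_lin)).
by apply: eq_csum => s s_pos _; apply: rhd_nested.
Qed.

Lemma comp_sum_ad_der p r : (0 < p)%N ->
  comp_sum p br rhd x r.+1 = iter p.-1 ad_der delta0 r.
Proof.
move=> p_gt0; rewrite iter_ad_der prednK // -(comp_sum_csum (N := p)) //.
by apply: eq_bigr => a _; rewrite scaler_nat.
Qed.

End AdDerivation.

(** * Vector-valued polynomial functions over an infinite field *)

Section PolynomialFunctions.
Variable k : fieldType.

Definition vhorner (V : lmodType k) (s : seq V) (t : k) : V :=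
  foldr (fun v a => v + t *: a) 0 s.

Definition polyfun (V : lmodType k) (f : k -> V) : Prop :=
  exists s, f =1 vhorner s.

Section Closure.
Variables V W : lmodType k.
Implicit Types f h : k -> V.

Lemma polyfun_cst (v : V) : polyfun (fun=> v).
Proof. by exists [:: v] => t /=; rewrite scaler0 addr0. Qed.

Lemma polyfunD f h : polyfun f -> polyfun h -> polyfun (fun t => f t + h t).
Proof.
move=> [s fs] [s' hs].
suff [s2 E] : exists s2, forall t, vhorner s t + vhorner s' t = vhorner s2 t.
  by exists s2 => t; rewrite fs hs E.
elim: s s' {fs hs} => [|v s IH] s'; first by exists s' => t; rewrite /= add0r.
case: s' => [|v' s']; first by exists (v :: s) => t; rewrite /= addr0.
have [s2 E] := IH s'.
by exists (v + v' :: s2) => t /=; rewrite -E scalerDr addrACA.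
Qed.

Lemma polyfun_mulX f : polyfun f -> polyfun (fun t => t *: f t).
Proof. by move=> [s fs]; exists (0 :: s) => t /=; rewrite fs add0r. Qed.

Lemma polyfun_mulXn n f : polyfun f -> polyfun (fun t => t ^+ n *: f t).
Proof.
elim: n f => [|n IH] f pf.
  by case: pf => s fs; exists s => t; rewrite expr0 scale1r.
have [s E] := IH _ (polyfun_mulX pf).
by exists s => t; rewrite exprSr -scalerA E.
Qed.

Lemma polyfun_lin (L : V -> W) f :
  linear L -> polyfun f -> polyfun (fun t => L (f t)).
Proof.
move=> lL [s fs]; exists (map L s) => t; rewrite fs.
by elim: s {fs} => [|v s IH] /=; rewrite ?lin0 // linD // linZ // IH.
Qed.

Lemma polyfunZ (a : k) f : polyfun f -> polyfun (fun t => a *: f t).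
Proof.
move=> [s fs]; exists (map (fun v => a *: v) s) => t; rewrite fs.
elim: s {fs} => [|v s IH] /=; rewrite ?scaler0 // scalerDr -IH !scalerA.
by rewrite mulrC.
Qed.

Lemma polyfun_sum (I : Type) (r : seq I) (F : I -> k -> V) :
  (forall i, polyfun (F i)) -> polyfun (fun t => \sum_(i <- r) F i t).
Proof.
move=> pF; elim: r => [|i r [s IH]].
  by exists [::] => t; rewrite big_nil.
have [s' E] : polyfun (fun t => F i t + vhorner s t).
  by apply: polyfunD (pF i) _; exists s.
by exists s' => t; rewrite big_cons IH E.
Qed.

End Closure.

Lemma polyfun_bilin (V W U : lmodType k) (B : V -> W -> U)
    (f : k -> V) (h : k -> W) :
  bilinear_map B -> polyfun f -> polyfun h -> polyfun (fun t => B (f t) (h t)).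
Proof.
move=> [lr ll] [s fs] ph.
suff [s2 E] : polyfun (fun t => B (vhorner s t) (h t)).
  by exists s2 => t; rewrite fs E.
elim: s {fs} => [|v s IH].
  by exists [::] => t /=; rewrite (lin0 (ll (h t))).
have [s2 E] := polyfunD (polyfun_lin (lr v) ph) (polyfun_mulX IH).
by exists s2 => t; rewrite -E /= (linD (ll (h t))) (linZ (ll (h t))).
Qed.

Lemma polyfun_pair (V W : lmodType k) (f : k -> V) (h : k -> W) :
  polyfun f -> polyfun h -> polyfun (fun t => (f t, h t)).
Proof.
move=> pf ph.
have l1 : linear (fun v : V => (v, 0 : W)).
  by move=> a v w /=; congr (_, _); rewrite /= scaler0 addr0.
have l2 : linear (fun w : W => (0 : V, w)).
  by move=> a v w /=; congr (_, _); rewrite /= scaler0 addr0.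
have [s E] := polyfunD (polyfun_lin l1 pf) (polyfun_lin l2 ph).
by exists s => t; rewrite -E; congr (_, _); rewrite /= ?addr0 ?add0r.
Qed.

Section Density.
Hypothesis k_inf : forall L : seq k, exists a, a \notin L.
Variable V : lmodType k.

(** Induction on the number of coefficients: a zero [a] outside [L] allows division by [t - a], and
    the quotient vanishes outside [a :: L]. *)
Lemma vhorner_eq0 (s : seq V) (L : seq k) :
  (forall t, t \notin L -> vhorner s t = 0) -> forall t, vhorner s t = 0.
Proof.
have [n] := ubnP (size s); elim: n s L => // n IH [//|v s] L le_s s0.
have vc (w : V) s' t : vhorner (w :: s') t = w + t *: vhorner s' t by [].
(* Synthetic division by [t - a], with the value at [a] as remainder. *)
have vdiv a (w : V) s' : exists2 s2, size s2 = size s' &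
    forall t, vhorner (w :: s') t = vhorner (w :: s') a + (t - a) *: vhorner s2 t.
  elim: s' w => [|w' s' IHs] w.
    by exists [::] => // t /=; rewrite !scaler0 !addr0.
  have [s2 sz E] := IHs w'; exists (vhorner (w' :: s') a :: s2) => [|t].
    by rewrite /= sz.
  rewrite [vhorner (w :: _) t]vc [vhorner (w :: _) a]vc [vhorner (_ :: s2) t]vc E.
  move: (vhorner _ a) (vhorner _ t) => A B.
  rewrite -!addrA; congr (_ + _); rewrite !scalerDr !scalerA addrA -scalerDl.
  by rewrite [a + _]addrC subrK mulrC.
have [a aL] := k_inf L; have [s2 sz E] := vdiv a v s.
have E0 t : vhorner (v :: s) t = (t - a) *: vhorner s2 t.
  by rewrite E s0 // add0r.
move=> t; rewrite E0 (IH s2 (a :: L)) ?scaler0 ?sz //.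
move=> u; rewrite inE negb_or => /andP[ua uL].
have /eqP := E0 u; rewrite s0 // eq_sym scaler_eq0.
by rewrite subr_eq0 (negPf ua) => /eqP.
Qed.

Lemma polyfun_ext (f h : k -> V) : polyfun f -> polyfun h ->
  (forall t, t != 0 -> f t = h t) -> f =1 h.
Proof.
move=> pf ph efh t; have [s E] := polyfunD pf (polyfunZ (-1) ph).
apply/eqP; rewrite -subr_eq0 -scaleN1r E (@vhorner_eq0 s [:: 0]) // => u.
by rewrite inE -E => u0; rewrite efh // scaleN1r subrr.
Qed.

End Density.
End PolynomialFunctions.

Lemma closed_field_infinite (k : closedFieldType) (L : seq k) :
  exists a, a \notin L.
Proof.
have P0 : \prod_(b <- L) ('X - b%:P) != 0 by exact: monic_neq0 (monic_prod_XsubC _ _ _).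
have [a] := PreClosedField.closed_nonrootP (@solve_monicpoly k) _ P0.
by rewrite root_prod_XsubC; exists a.
Qed.

(** * Morphisms and pullback of restricted structures *)

Section RestrictedMorphisms.
Variables (k : fieldType) (p : nat) (L g : lmodType k).
Variables (brL : L -> L -> L) (pmL : L -> L) (br : g -> g -> g) (pm : g -> g).

Record restricted_mor (f : L -> g) : Prop := RestrictedMor {
  mor_lin : linear f;
  mor_br : forall x y, f (brL x y) = br (f x) (f y);
  mor_pm : forall x, f (pmL x) = pm (f x)
}.

Lemma mor_jacobson f x y i : restricted_mor f ->
  f (jacobson_s p brL x y i) = jacobson_s p br (f x) (f y) i.
Proof.
case=> lf fb _; rewrite /jacobson_s linZ //; congr (_ *: _).
elim: (p.-1) (i.-1) => [|n IH] [|j] //=; rewrite ?lin0 //.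
  by rewrite /ad_txy linD // lin0 // fb IH.
by rewrite /ad_txy linD // !fb !IH.
Qed.

Lemma mor_sum (f : L -> g) (lf : linear f) (I : Type) (r : seq I) (F : I -> L) :
  f (\sum_(i <- r) F i) = \sum_(i <- r) f (F i).
Proof. exact: (big_morph f (linD lf) (lin0 lf)). Qed.

(** Both morphisms carry each axiom to the one that holds in [g], and joint injectivity brings it
    back. *)
Lemma restricted_pullback f1 f2 :
  restricted_mor f1 -> restricted_mor f2 ->
  (forall x y, f1 x = f1 y -> f2 x = f2 y -> x = y) ->
  is_restricted_lie p br pm -> is_restricted_lie p brL pmL.
Proof.
move=> m1 m2 inj [[[lr ll] alt jac] pZ pA pD].
have [l1 b1 p1] := m1; have [l2 b2 p2] := m2.
have iterE f n x y : restricted_mor f ->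
    f (iter n (brL x) y) = iter n (br (f x)) (f y).
  by case=> lf fb _; elim: n => //= n IH; rewrite fb IH.
split; first split.
- split=> [x a y z|x a y z]; apply: inj;
    rewrite ?(linD l1, linD l2) ?(linZ l1, linZ l2) ?(b1, b2)
      ?(linD l1, linD l2) ?(linZ l1, linZ l2).
  + by rewrite linD // linZ.
  + by rewrite linD // linZ.
  + by rewrite (linD (ll _)) (linZ (ll _)).
  + by rewrite (linD (ll _)) (linZ (ll _)).
- by move=> x; apply: inj; rewrite ?b1 ?b2 alt lin0.
- move=> x y z; apply: inj; rewrite ?(linD l1, linD l2) ?(b1, b2) ?jac;
  by rewrite lin0.
- by move=> a x; apply: inj; rewrite ?p1 ?p2 linZ // pZ linZ // ?p1 ?p2.
- by move=> x y; apply: inj; rewrite ?b1 ?b2 ?p1 ?p2 iterE.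
- move=> x y; apply: inj.
    rewrite p1 !(linD l1) pD !p1 mor_sum //; congr (_ + _).
    by apply: eq_bigr => i _; rewrite mor_jacobson.
  rewrite p2 !(linD l2) pD !p2 mor_sum //; congr (_ + _).
  by apply: eq_bigr => i _; rewrite mor_jacobson.
Qed.

End RestrictedMorphisms.

(** * The family of semidirect products [L_t] *)

Section Semidirect.
Variables (k : fieldType) (p : nat) (g : lmodType k).
Variables (br : g -> g -> g) (pm : g -> g).
Hypotheses (p_gt0 : (0 < p)%N) (hg : is_restricted_lie p br pm).
Local Notation L := (g * g)%type.

(* The semidirect product of [g], acting by the adjoint representation, with
   the Lie algebra [(g, t br)]; for [t != 0] it is isomorphic to [g * g] by
   [(a, u) |-> (a, a + t u)]. *)
Definition sd_br (t : k) (X Y : L) : L :=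
  (br X.1 Y.1, br X.1 Y.2 + br X.2 Y.1 + t *: br X.2 Y.2).

(** For [t != 0] the second component is [((a + t u)^[p] - a^[p]) / t], expanded by Jacobson's
    formula so that it also makes sense at [t = 0]. *)
Definition sd_pm (t : k) (X : L) : L :=
  (pm X.1, t ^+ p.-1 *: pm X.2
           + \sum_(1 <= r < p) t ^+ r.-1 *: jacobson_s p br X.2 X.1 r).

Let br_bilin : bilinear_map br := lie_bilinear (restricted_lie hg).

(** Each power of the indeterminate comes with one factor [t], and the vector to which the operator
    is applied brings one more. *)
Lemma jacobson_sZ t u a i : (0 < i)%N ->
  jacobson_s p br (t *: u) a i = t ^+ i *: jacobson_s p br u a i.
Proof.
have [lr ll] := br_bilin.
case: i => // i _; rewrite /jacobson_s scalerA mulrC -scalerA /=.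
congr (_ *: _); elim: (p.-1) i => [|n IH] [|i] /=.
- by rewrite expr1.
- by rewrite scaler0.
- by rewrite /ad_txy !add0r IH linZ.
- by rewrite /ad_txy !IH (linZ (ll _)) !(linZ (lr _)) scalerDr !scalerA -exprS.
Qed.

Lemma sd_mor_fst t : restricted_mor (sd_br t) (sd_pm t) br pm fst.
Proof. by []. Qed.

Lemma sd_mor_add t :
  restricted_mor (sd_br t) (sd_pm t) br pm (fun X : L => X.1 + t *: X.2).
Proof.
have [lr ll] := br_bilin; split.
- move=> a X Y /=; rewrite !scalerDr !scalerA addrACA; congr (_ + _ + _).
  by rewrite mulrC.
- move=> X Y /=.
  rewrite (linD (ll _)) !(linD (lr _)) !(linZ (ll _)) !(linZ (lr _)).
  by rewrite !scalerDr !addrA.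
- move=> X /=; rewrite [in RHS]addrC (pmapD hg) (pmapZ hg) scalerDr scalerA.
  rewrite -exprS prednK // addrA [pm _ + _]addrC; congr (_ + _).
  rewrite scaler_sumr; apply: eq_big_nat => i /andP[i_gt0 _].
  by rewrite scalerA -exprS prednK // jacobson_sZ.
Qed.

Lemma sd_restricted_neq0 t : t != 0 -> is_restricted_lie p (sd_br t) (sd_pm t).
Proof.
move=> t0; apply: restricted_pullback (sd_mor_fst t) (sd_mor_add t) _ hg.
move=> [a u] [b v] /= -> /addrI E; congr (_, _).
by apply: (scalerI t0).
Qed.

Hypothesis k_inf : forall S : seq k, exists a, a \notin S.

Lemma polyfun_sd_br (F G : k -> L) :
  polyfun F -> polyfun G -> polyfun (fun t => sd_br t (F t) (G t)).
Proof.
move=> pF pG.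
have l1 : linear (fst : L -> g) by [].
have l2 : linear (snd : L -> g) by [].
have [pF1 pF2] := (polyfun_lin l1 pF, polyfun_lin l2 pF).
have [pG1 pG2] := (polyfun_lin l1 pG, polyfun_lin l2 pG).
by apply: polyfun_pair; last (apply: polyfunD; [apply: polyfunD|apply: polyfun_mulX]);
  apply: polyfun_bilin.
Qed.

Lemma polyfun_sd_pm (X : L) : polyfun (fun t => sd_pm t X).
Proof.
apply: polyfun_pair; first exact: polyfun_cst.
apply: polyfunD; first exact/polyfun_mulXn/polyfun_cst.
by apply: polyfun_sum => r; exact/polyfun_mulXn/polyfun_cst.
Qed.

Lemma polyfun_jacobson X Y i : polyfun (fun t => jacobson_s p (sd_br t) X Y i).
Proof.
apply: polyfunZ; elim: (p.-1) (i.-1) => [|n IH] j /=.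
  by case: j => [|j]; apply: polyfun_cst.
apply: polyfunD; last exact: polyfun_sd_br (polyfun_cst _) (IH _).
case: j => [|j]; first exact: polyfun_cst.
exact: polyfun_sd_br (polyfun_cst _) (IH _).
Qed.

(** The value [t = 0] has to be covered because [lam] may be zero. For fixed arguments both sides of
    every axiom are polynomial functions of [t], so [polyfun_ext] reduces to [t != 0]. *)
Lemma sd_restricted t : is_restricted_lie p (sd_br t) (sd_pm t).
Proof.
have H := sd_restricted_neq0.
have C := @polyfun_cst k (GRing.Lmodule.clone k L _).
have B := polyfun_sd_br; have P := polyfun_sd_pm; have ext := polyfun_ext k_inf.
split; first split; first split.
- move=> x a y z; move: t; apply: ext => [||t /H [[[lr ll] _ _] _ _ _]].
  + exact: B.
  + by apply: polyfunD; [apply: polyfunZ|]; apply: B.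
  + exact: lr.
- move=> x a y z; move: t; apply: ext => [||t /H [[[lr ll] _ _] _ _ _]].
  + exact: B.
  + by apply: polyfunD; [apply: polyfunZ|]; apply: B.
  + exact: ll.
- move=> x; move: t; apply: ext => [||t /H [[_ alt _] _ _ _]] //.
  exact: B.
- move=> x y z; move: t; apply: ext => [||t /H [[_ _ jac] _ _ _]] //.
  by apply: polyfunD; [apply: polyfunD|]; apply: (B) => //; apply: (B).
- move=> a x; move: t; apply: ext => [||t /H [_ pZ _ _]] //.
  exact: polyfunZ.
- move=> x y; move: t; apply: ext => [||t /H [_ _ pA _]] //.
    exact: B.
  by elim: (p in iter p) => [|n IH] /=; [apply: C|apply: B].
- move=> x y; move: t; apply: ext => [||t /H [_ _ _ pD]] //.
  apply: polyfunD; first exact: polyfunD.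
  by apply: polyfun_sum => i; apply: polyfun_jacobson.
Qed.

End Semidirect.

(** * Jacobson's formula for left multiplication plus a derivation *)

Section JacobsonDerivation.
Variables (k : fieldType) (A : algType k) (D : A -> A) (x : A).
Hypotheses (D_lin : linear D) (D_der : forall a b, D (a * b) = D a * b + a * D b).

Local Notation Dp := (map_poly D).
Local Notation xt := (x%:P * 'X).

Let D0 : D 0 = 0 := lin0 D_lin.
Let D1 : D 1 = 0.
Proof. by have /eqP := D_der 1 1; rewrite !mulr1 mul1r -subr_eq subrr => /eqP. Qed.
Let DMn a n : D (a *+ n) = D a *+ n.
Proof. by rewrite -!scaler_nat linZ. Qed.
Let D_sum n (F : 'I_n -> A) : D (\sum_(i < n) F i) = \sum_(i < n) D (F i).
Proof. exact: (big_morph D (linD D_lin) D0). Qed.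

(* The operator [w |-> t x w + D w] on [A[t]], and the derivation
   [ad_(t x + D)] that measures its failure to commute with multiplications. *)
Let E (q : {poly A}) := xt * q + Dp q.
Let der (q : {poly A}) := xt * q - q * xt + Dp q.

Let coef_Dp q i : (Dp q)`_i = D q`_i.
Proof. exact: coef_map_id0. Qed.

Let DpM q r : Dp (q * r) = Dp q * r + q * Dp r.
Proof.
apply/polyP => i; rewrite coef_Dp coefD !coefM D_sum -big_split.
by apply: eq_bigr => j _; rewrite D_der !coef_Dp.
Qed.

Let DpD q r : Dp (q + r) = Dp q + Dp r.
Proof. by apply/polyP => i; rewrite coefD !coef_Dp coefD linD. Qed.

Let E_mul q r : E (q * r) = der q * r + q * E r.
Proof.
rewrite /E /der DpM !mulrDl mulrDr mulNr !mulrA -[RHS]addrA.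
by rewrite [X in _ = _ + X]addrCA [RHS]addrA subrK.
Qed.

Let E_add q r : E (q + r) = E q + E r.
Proof. by rewrite /E DpD mulrDr addrACA. Qed.

Let E0 : E 0 = 0.
Proof. by rewrite /E mulr0 add0r; apply/polyP => i; rewrite coef_Dp !coef0. Qed.

Let EMn q n : E (q *+ n) = E q *+ n.
Proof. by elim: n => [|n IH]; rewrite ?mulr0n // !mulrS E_add IH. Qed.

Let E_deriv q : (E q)^`() = x%:P * q + E q^`().
Proof.
rewrite /E derivD !derivM derivC derivX mul0r add0r mulr1 -addrA; congr (_ + (_ + _)).
by apply/polyP => i; rewrite coef_deriv !coef_Dp coef_deriv DMn.
Qed.

Let W n := iter n E 1.
Let d n := iter n der x%:P.

(** The derivative in [t] commutes with [E] up to left multiplication by [x], and moving [E] past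
    [d i] produces [d i.+1]; the binomials accumulate by Pascal's rule. *)
Let W_deriv n : (W n)^`() = \sum_(i < n) (d i * W (n - i.+1)) *+ 'C(n, i.+1).
Proof.
elim: n => [|n IH]; first by rewrite big_ord0 derivC.
rewrite [W n.+1]iterS E_deriv -/(W n) IH (big_morph E E_add E0).
under [RHS]eq_bigr => i _ do rewrite binS mulrnDr subSS.
rewrite [RHS]big_split /= big_ord_recr /= bin_small // mulr0n addr0.
rewrite [X in _ = _ + X]big_ord_recl subn0 bin0 mulr1n [RHS]addrCA.
congr (_ + _); rewrite -big_split; apply: eq_bigr => i _.
rewrite EMn E_mul mulrnDl addrC lift0; congr (_ *+ _ + _).
by rewrite -[E _]/(W (n - i.+1).+1) subnSK.
Qed.

Let coef_E_0 q : (E q)`_0 = D q`_0.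
Proof. by rewrite coefD coef_Dp -mulrA coefCM coefXM mulr0 add0r. Qed.

Let coef_E_S q i : (E q)`_i.+1 = x * q`_i + D q`_i.+1.
Proof. by rewrite coefD coef_Dp -mulrA coefCM coefXM. Qed.

Let W_coef_gt n i : (n < i)%N -> (W n)`_i = 0.
Proof.
elim: n i => [|n IH] [|i] // lt_ni; first by rewrite coef1.
by rewrite [W _]iterS coef_E_S !IH ?mulr0 ?add0r ?D0 // ltnW.
Qed.

Let W_coef_n n : (W n)`_n = x ^+ n.
Proof.
elim: n => [|n IH]; first by rewrite coef1.
by rewrite [W _]iterS coef_E_S IH W_coef_gt // D0 addr0 exprS.
Qed.

Let W_coef_0 n : (0 < n)%N -> (W n)`_0 = 0.
Proof.
case: n => // n _; elim: n => [|n IH]; rewrite [W _]iterS coef_E_0.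
  by rewrite coef1 D1.
by rewrite IH.
Qed.

(** This is evaluation at [t = 1], where [E] becomes [w |-> x * w + D w]; [W n] has degree at most
    [n]. *)
Let W_sum n : iter n (fun w => x * w + D w) 1 = \sum_(i < n.+1) (W n)`_i.
Proof.
elim: n => [|n IH]; first by rewrite big_ord1 coef1.
rewrite iterS IH [RHS]big_ord_recl [W n.+1]iterS coef_E_0.
under [X in _ = _ + X]eq_bigr => i _ do rewrite lift0 coef_E_S.
rewrite big_split -mulr_sumr [RHS]addrCA; congr (_ + _).
rewrite -D_sum -(linD D_lin) -(big_ord_recl n.+1 (fun i : 'I_n.+2 => (W n)`_i)).
by rewrite [in RHS]big_ord_recr /= W_coef_gt // addr0.
Qed.

Let coef_d n i :
  (d n)`_i = iter n (ad_der (fun a b => a * b - b * a) (fun=> D) x) (delta0 x) i.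
Proof.
elim: n i => [|n IH] i; first by rewrite coefC; case: i.
rewrite [d _]iterS coefD coefB coef_Dp -mulrA coefCM coefXM mulrA coefMX coefMC.
rewrite -/(d n) iterS /ad_der -IH; congr (_ + _).
by case: i => [|i] /=; rewrite ?mulr0 ?subrr // IH.
Qed.

(* Jacobson's formula for [(L_x + D)^p], with [L_x] the left multiplication,
   evaluated at [1], where [D^p] vanishes. *)
Lemma jacobson_derivation p : p \in [pchar k] ->
  iter p (fun w => x * w + D w) 1 = x ^+ p + \sum_(1 <= i < p)
    i%:R^-1 *: iter p.-1 (ad_der (fun a b => a * b - b * a) (fun=> D) x)
                 (delta0 x) i.-1.
Proof.
move=> hp; have p_pr := pcharf_prime hp; have p_gt0 := prime_gt0 p_pr.
(* For [n = p] every binomial in [W_deriv] except the last is divisible by [p], and [W 0 = 1]. *)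
have Wd : (W p)^`() = d p.-1.
  rewrite W_deriv; case: p hp p_pr {p_gt0} => // q hq q_pr.
  rewrite big_ord_recr binn mulr1n subnn [W 0]/= mulr1 big1 => [|i _]; first exact: add0r.
  have /dvdnP[c ->] : (q.+1 %| 'C(q.+1, i.+1))%N.
    by apply: prime_dvd_bin; rewrite //= ltnS.
  rewrite mulrnA -mulr_natr; apply/polyP => j.
  rewrite -[_%:R]/(q.+1%:R : {poly A}) -polyC_natr coefMC.
  have -> : q.+1%:R = 0 :> A by rewrite -scaler_nat (pcharf0 hq) scale0r.
  by rewrite mulr0 coef0.
(* The top coefficient is [x ^+ p], the constant one vanishes because [D 1 = 0], and for [0 < i < p]
   the coefficient of [t^i] is [1/i] times that of [t^(i-1)] in the derivative. *)
rewrite W_sum big_ord_recr /= W_coef_n addrC; congr (_ + _).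
rewrite -(big_mkord xpredT (fun i => (W p)`_i)) big_ltn // W_coef_0 // add0r.
apply: eq_big_nat => i /andP[i_gt0 lt_ip].
rewrite -coef_d -Wd coef_deriv prednK // -scaler_nat scalerA mulVf ?scale1r //.
by rewrite -(dvdn_pcharf hp) gtnNdvd.
Qed.

End JacobsonDerivation.

(** * Grossman-Larson powers of primitive elements *)

Section GrossmanLarsonPower.
Variables (k : fieldType) (p : nat) (g : lmodType k) (br rhd : g -> g -> g).
Hypotheses (hp : p \in [pchar k]) (hpl : is_postlie br rhd).
Local Notation U := (uea br).
Variable ext : U -> U -> U.
Hypothesis hext : is_guin_oudom rhd ext.
Variable x : g.
Local Notation X := (uea_in br x).

Lemma sweedler_in (W : lmodType k) (f : U -> U -> W) : bilinear_map f ->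
  sweedler f X = f X 1 + f 1 X.
Proof.
move=> bf; rewrite /sweedler uea_delta_in (linD (tens_lift_linear bf)).
by rewrite !tens_lift_pure.
Qed.

Lemma gl_mul_in u : gl_mul ext X u = X * u + ext X u.
Proof.
have [lr ll] := go_bilinear hext.
rewrite /gl_mul sweedler_in; first by rewrite (go_1l hext) mul1r.
split=> [v a u1 u2|v a u1 u2] /=; last by rewrite mulrDl scalerAl.
by rewrite (linD (ll u)) (linZ (ll u)) mulrDr scalerAr.
Qed.

(** Primitivity of [X] turns the Sweedler rule for products into the Leibniz rule, so [ext X] can
    serve as [D] in [jacobson_derivation]. *)
Lemma ext_in_der u v : ext X (u * v) = ext X u * v + u * ext X v.
Proof.
have [lr ll] := go_bilinear hext.
rewrite (go_mul hext) sweedler_in; first by rewrite !(go_1l hext).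
split=> [w a u1 u2|w a u1 u2] /=.
  by rewrite (linD (ll v)) (linZ (ll v)) mulrDr scalerAr.
by rewrite (linD (ll u)) (linZ (ll u)) mulrDl scalerAl.
Qed.

Lemma ext_in_1 : ext X 1 = 0.
Proof.
rewrite (go_1r hext) /uea_eps uea_lift_in ?scale0r // => [a y z|y z] /=.
  by rewrite scaler0 addr0.
by rewrite subrr.
Qed.

Lemma gl_pow_in :
  gl_pow ext X p - uea_in br (\sum_(1 <= r < p) r%:R^-1 *: comp_sum p br rhd x r)
    = X ^+ p.
Proof.
have p_gt0 := prime_gt0 (pcharf_prime hp).
(* [gl_pow] starts at [X] and multiplies [p - 1] times; starting at 1, the first step already gives
   [X] because [ext X 1 = 0]. *)
have -> : gl_pow ext X p = iter p (fun w => X * w + ext X w) 1.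
  rewrite /gl_pow; case: (p) p_gt0 => // n _; rewrite iterSr mulr1 ext_in_1 addr0.
  by elim: n => //= n ->; rewrite gl_mul_in.
have [lr ll] := go_bilinear hext.
rewrite (jacobson_derivation X (lr X) ext_in_der hp).
rewrite -[RHS](addrK (uea_in br (\sum_(1 <= r < p) r%:R^-1 *: comp_sum p br rhd x r))).
congr (_ + _ - _).
have lin := uea_in_linear br.
rewrite (big_morph _ (linD lin) (lin0 lin)); apply: eq_big_nat => r.
case: r => // r _; rewrite linZ // (comp_sum_ad_der (lie_bilinear
  (postlie_lie hpl)) ((postlie_bilinear hpl).1 x) (postlie_der hpl x)) //.
(* [uea_in] carries [br] to commutators and [rhd x] to [ext X], hence the coefficient sequences in
   [g] to those in the enveloping algebra. *)
congr (_ *: _); rewrite /=; elim: (p.-1) r => [|n IH] r /=.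
  by case: r => //=; rewrite lin0.
rewrite /ad_der linD //; congr (_ + _); last by rewrite IH (go_extends hext).
by case: r => [|r]; rewrite ?lin0 // uea_in_br IH.
Qed.

End GrossmanLarsonPower.

(** * Rescaled and descendent structures of a Rota-Baxter operator *)

Section RotaBaxter.
Variables (k : fieldType) (p : nat) (hp : p \in [pchar k]) (g : lmodType k).
Variables (br : g -> g -> g) (pm R : g -> g) (lam : k).

Section Scaled.
Hypothesis hg : is_restricted_lie p br pm.
Local Notation brl := (scaled_br br lam).

Let br_bilin : bilinear_map br := lie_bilinear (restricted_lie hg).
Let p_gt0 : (0 < p)%N := prime_gt0 (pcharf_prime hp).

Lemma lie_antisym x y : br x y = - br y x.
Proof.
have [lr ll] := br_bilin; have alt := lie_alt (restricted_lie hg).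
apply/eqP; rewrite -addr_eq0; apply/eqP; have := alt (x + y).
by rewrite (linD (ll _)) !(linD (lr _)) !alt add0r addr0.
Qed.

Lemma lie_ad_der x y z : br x (br y z) = br (br x y) z + br y (br x z).
Proof.
have [lr ll] := br_bilin; have jac := lie_jacobi (restricted_lie hg) x y z.
rewrite (lie_antisym (br x y)) addrC; apply/eqP.
rewrite -subr_eq0 opprD opprK -[X in _ == X]jac addrA; apply/eqP.
congr (_ + _ + _); rewrite (lie_antisym z x) -scaleN1r (linZ (lr y)).
by rewrite scaleN1r.
Qed.

Lemma scaled_bilinear : bilinear_map brl.
Proof.
have [lr ll] := br_bilin.
by split=> [x a y z|x a y z]; rewrite /scaled_br ?(linD (lr _)) ?(linZ (lr _))
  ?(linD (ll _)) ?(linZ (ll _)) scalerDr !scalerA [a * _]mulrC.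
Qed.

(** A nonempty list of [r] entries gives [r - 1] brackets, each contributing [lam]; this is the
    source of [lam ^+ r.-1] in [rb_pmap]. *)
Lemma nested_br_scaled s :
  nested_br brl s = lam ^+ (size s).-1 *: nested_br br s.
Proof.
have [lr ll] := br_bilin.
elim: s => [|x [|y s] IH]; rewrite ?scale1r ?scaler0 //.
rewrite [LHS]/(brl x (nested_br brl (y :: s))) IH /scaled_br (linZ (lr _)).
by rewrite scalerA -exprS.
Qed.

Lemma comp_sum_scaled rhd x r :
  comp_sum p brl rhd x r = lam ^+ r.-1 *: comp_sum p br rhd x r.
Proof.
rewrite scaler_sumr; apply: eq_bigr => a _.
by rewrite nested_br_scaled !size_map size_tuple !scalerA mulrC.
Qed.

Lemma sub_pmap_scaled x :
  sub_pmap p brl (scaled_pmap p pm lam) (rb_rhd br R) x = rb_pmap p br pm R lam x.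
Proof.
congr (_ + _); apply: eq_bigr => r _.
by rewrite comp_sum_scaled scalerA.
Qed.

Lemma iter_scaled n x y : iter n (brl x) y = lam ^+ n *: iter n (br x) y.
Proof.
have [lr ll] := br_bilin.
elim: n => [|n IH] /=; first by rewrite scale1r.
by rewrite IH /scaled_br (linZ (lr _)) scalerA -exprS.
Qed.

Lemma jacobson_scaled x y i :
  jacobson_s p brl x y i = lam ^+ p.-1 *: jacobson_s p br x y i.
Proof.
have [lr ll] := br_bilin.
rewrite /jacobson_s scalerA mulrC -scalerA; congr (_ *: _).
elim: (p.-1) (i.-1) => [|n IH] j /=; first by rewrite scale1r.
rewrite /ad_txy /scaled_br scalerDr exprS; congr (_ + _).
  by case: j => [|j]; rewrite ?scaler0 // IH (linZ (lr _)) scalerA.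
by rewrite IH (linZ (lr _)) scalerA.
Qed.

Lemma scaled_restricted : is_restricted_lie p brl (scaled_pmap p pm lam).
Proof.
have [lr ll] := br_bilin; have [[_ alt jac] pZ pA pD] := hg.
split; first split.
- exact: scaled_bilinear.
- by move=> x; rewrite /scaled_br alt scaler0.
- by move=> x y z; rewrite /scaled_br !(linZ (lr _)) -!scalerDr jac !scaler0.
- by move=> a x; rewrite /scaled_pmap pZ !scalerA mulrC.
- move=> x y; rewrite iter_scaled -pA /scaled_br (linZ (ll _)) scalerA -exprS.
  by rewrite prednK.
- move=> x y; rewrite /scaled_pmap pD !scalerDr; congr (_ + _).
  by rewrite scaler_sumr; apply: eq_bigr => i _; rewrite jacobson_scaled.
Qed.

End Scaled.

Hypothesis hR : is_restricted_rota_baxter p br pm R lam.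
Let hg := rrb_restricted hR.
Let p_gt0 : (0 < p)%N := prime_gt0 (pcharf_prime hp).

Lemma sub_br_scaled x y :
  sub_br (scaled_br br lam) (rb_rhd br R) x y = rb_br br R lam x y.
Proof. by rewrite /sub_br /rb_br /rb_rhd (lie_antisym hg x (R y)). Qed.

Lemma rb_sub_br x y : R (rb_br br R lam x y) = br (R x) (R y).
Proof.
have lR := rrb_linear hR.
by rewrite (rrb_rota_baxter hR) /rb_br !(linD lR) (linZ lR).
Qed.

(** [R] sends the descendent bracket and p-map to those of [g], so the two axioms on the left action
    of [rhd] become the Jacobi identity and [pmap_ad] at [R x]. *)
Lemma rb_restricted_postlie :
  is_restricted_postlie p (scaled_br br lam) (scaled_pmap p pm lam) (rb_rhd br R).
Proof.
have lR := rrb_linear hR.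
have [lr ll] := lie_bilinear (restricted_lie hg).
split; first split.
- exact: restricted_lie (scaled_restricted hg).
- by split=> [x|y a x z]; [apply: lr | rewrite /rb_rhd lR (ll y)].
- move=> x y z; rewrite /rb_rhd /scaled_br (linZ (lr _)) -scalerDr.
  by rewrite (lie_ad_der hg).
- move=> x y z.
  have -> : scaled_br br lam x y + rb_rhd br R x y - rb_rhd br R y x
          = rb_br br R lam x y.
    by rewrite -sub_br_scaled /sub_br -addrA addrC.
  by rewrite /rb_rhd rb_sub_br (lie_ad_der hg (R x)) addrK.
- exact: scaled_restricted.
(* Up to the common factor [lam ^+ p.-1]: [[R y, x^[p]] = - (ad_x)^p (R y) = (ad_x)^(p-1)
   [R y, x]]. *)
- move=> x y; rewrite /rb_rhd /scaled_pmap (linZ (lr _)) (lie_antisym hg).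
  rewrite (pmap_ad hg) -[in iter p _](prednK p_gt0) iterSr.
  rewrite (iter_scaled hg); congr (_ *: _).
  elim: (p.-1) => [|n IH] /=; first by rewrite -(lie_antisym hg).
  by rewrite -IH -scaleN1r -(linZ (lr x)) scaleN1r.
- move=> x y; rewrite /rb_rhd sub_pmap_scaled // (rrb_pmap hR).
  by rewrite (pmap_ad hg).
Qed.

Lemma rb_graph_mor : restricted_mor (rb_br br R lam) (rb_pmap p br pm R lam)
  (sd_br br lam) (sd_pm p br pm lam) (fun x => (R x, x)).
Proof.
have [lr ll] := lie_bilinear (restricted_lie hg); split.
- by move=> a x y /=; rewrite (rrb_linear hR).
- by move=> x y; rewrite rb_sub_br.
- move=> x; rewrite (rrb_pmap hR); congr (_, _ + _) => /=.
  (* With [D = ad_(R x)] the operator [ad_der] is [ad_txy] at [x] and [R x], so the composition sums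
     are the sums [r s_r(x, R x)]. *)
  apply: eq_big_nat => -[//|r] _; rewrite mulrC -scalerA; congr (_ *: _).
  by rewrite (@comp_sum_ad_der _ _ br (rb_rhd br R) x (lie_bilinear
    (restricted_lie hg)) (lr (R x)) (lie_ad_der hg (R x))).
Qed.

Lemma rb_restricted : (forall S : seq k, exists a, a \notin S) ->
  is_restricted_lie p (rb_br br R lam) (rb_pmap p br pm R lam).
Proof.
move=> k_inf.
apply: restricted_pullback rb_graph_mor rb_graph_mor _ (sd_restricted p_gt0 hg k_inf lam).
by move=> x y [].
Qed.

End RotaBaxter.

Theorem theorem4p9 (k : closedFieldType) (p : nat) (hp : p \in [pchar k])
    (g : lmodType k) (br : g -> g -> g) (pm : g -> g) (R : g -> g) (lam : k)
    (hR : is_restricted_rota_baxter p br pm R lam) :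
  [/\ is_restricted_postlie p (scaled_br br lam) (scaled_pmap p pm lam)
        (rb_rhd br R),
      (forall x y : g,
         sub_br (scaled_br br lam) (rb_rhd br R) x y = rb_br br R lam x y),
      (forall x : g,
         sub_pmap p (scaled_br br lam) (scaled_pmap p pm lam) (rb_rhd br R) x
         = rb_pmap p br pm R lam x),
      is_restricted_lie p (rb_br br R lam) (rb_pmap p br pm R lam)
    & forall ext : uea (scaled_br br lam) -> uea (scaled_br br lam) ->
                   uea (scaled_br br lam),
      is_guin_oudom (rb_rhd br R) ext ->
      forall x : g,
        gl_pow ext (uea_in (scaled_br br lam) x) p
          - uea_in (scaled_br br lam) (rb_pmap p br pm R lam x)
        = uea_in (scaled_br br lam) x ^+ p
          - uea_in (scaled_br br lam) (scaled_pmap p pm lam x)].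
Proof.
have hpl := rb_restricted_postlie hp hR.
split=> [|x y|x||ext hext x].
- exact: hpl.
- exact: (sub_br_scaled hR).
- exact: (sub_pmap_scaled _ _ (rrb_restricted hR)).
- by apply: (rb_restricted hp hR) => S; apply: closed_field_infinite.
(* As the subjacent p-map, [rb_pmap] is [scaled_pmap] plus the composition sum that [gl_pow_in]
   removes from the Grossman-Larson power. *)
- rewrite -(sub_pmap_scaled R lam (rrb_restricted hR)).
  rewrite (linD (uea_in_linear _)) opprD addrA addrAC.
  by rewrite (gl_pow_in hp (rpostlie_postlie hpl) hext).
Qed.
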